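(* Let $M(\phi,\xi,\eta,g_M)$ be a Kenmotsu manifold of dimension $2m+1$ and let $(N,g_N)$ be a Riemannian manifold of dimension $n$. Then there does not exist a Riemannian submersion $F:M(\phi,\xi,\eta,g_M)\to(N,g_N)$ such that the characteristic vector field $\xi$ is a vertical vector field.
   Context: An almost contact metric structure $(\phi,\xi,\eta,g)$ on a connected $(2m+1)$-dimensional differentiable manifold $M$ consists of a $(1,1)$-tensor field $\phi$, a vector field $\xi$ (the characteristic vector field), a $1$-form $\eta$ and a Riemannian metric $g$ with $\phi^2=-I+\eta\otimes\xi$, $\phi\xi=0$, $\eta\circ\phi=0$, $\eta(\xi)=1$, $g(\phi X,\phi Y)=g(X,Y)-\eta(X)\eta(Y)$, $g(\phi X,Y)+g(X,\phi Y)=0$ and $\eta(X)=g(X,\xi)$ for all vector fields $X,Y$ on $M$. The manifold $M$ with this structure is a Kenmotsu manifold if $(\nabla_X\phi)Y=g(\phi X,Y)\xi-\eta(Y)\phi X$ for all $X,Y$, where $\nabla$ is the Levi-Civita connection of $g$. A Riemannian submersion $F:(M,g_M)\to(N,g_N)$ between Riemannian manifolds is a smooth map which is onto, has maximal rank, and whose differential $F_*$ preserves the lengths of horizontal vectors. A vector field on $M$ is vertical if it is always tangent to the fibers $F^{-1}(q)$, $q\in N$ (i.e. it lies in $\ker F_*$), and horizontal if it is always orthogonal to the fibers (i.e. it lies in $(\ker F_* )^\perp$). *)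

(* Defs.v *)
(* MathComp-Analysis, over an arbitrary [R : realType]. *)
From HB Require Import structures.
From mathcomp Require Import all_boot all_order all_algebra.
From mathcomp Require Import all_classical all_reals all_analysis.

Set Implicit Arguments.
Unset Strict Implicit.
Unset Printing Implicit Defensive.

Import Order.TTheory GRing.Theory Num.Theory.
Import numFieldNormedType.Exports.
Local Open Scope classical_set_scope.
Local Open Scope ring_scope.

(* [Ck k U f] is meant for an open set [U]. *)
Fixpoint Ck (R : realType) (V W : normedModType R) (k : nat)
    (U : set V) (f : V -> W) : Prop :=
  match k with
  | 0 => forall x, U x -> {for x, continuous f}
  | k'.+1 => (forall x, U x -> differentiable f x) /\
             (forall v, Ck k' U (fun x => 'd f x v))
  end.

Definition smooth_on (R : realType) (V W : normedModType R)
    (U : set V) (f : V -> W) : Prop :=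
  forall k, Ck k U f.

(* [chart_inv] is only constrained on the image of the chart, and the chart
   itself only on its domain. *)
Record chart (R : realType) (n : nat) (T : topologicalType) := Chart {
  chart_map :> T -> 'rV[R]_n;
  chart_inv : 'rV[R]_n -> T;
  chart_dom : set T;
  chart_dom_open : open chart_dom;
  chart_img_open : open (chart_map @` chart_dom);
  chart_mapK : forall p, chart_dom p -> chart_inv (chart_map p) = p;
  chart_map_continuous : forall p, chart_dom p -> {for p, continuous chart_map};
  chart_inv_continuous :
    forall y, (chart_map @` chart_dom) y -> {for y, continuous chart_inv} }.

Definition chart_img (R : realType) (n : nat) (T : topologicalType)
    (c : chart R n T) : set 'rV[R]_n :=
  c @` chart_dom c.

(* The atlas need not be maximal: every notion below depends only on the smooth
   structure that it generates.  [chart_at p] is a chosen chart around [p]; it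
   serves to identify the tangent space at [p] with R^n. *)
Record manifold (R : realType) (n : nat) := Manifold {
  manifold_space :> topologicalType;
  atlas : set (chart R n manifold_space);
  chart_at : manifold_space -> chart R n manifold_space;
  chart_at_atlas : forall p, atlas (chart_at p);
  chart_at_dom : forall p, chart_dom (chart_at p) p;
  atlas_compatible : forall c d, atlas c -> atlas d ->
    smooth_on (c @` (chart_dom c `&` chart_dom d)) (d \o chart_inv c);
  manifold_hausdorff : hausdorff_space manifold_space;
  manifold_second_countable : @second_countable manifold_space;
  manifold_nonempty : [set: manifold_space] !=set0 }.

Section Fields.
Context (R : realType) (n : nat) (M : manifold R n).

(* The tangent space at [p] is 'rV[R]_n, a vector [u] standing for the velocity
   of a curve read in the chart [chart_at p].  A vector field is thus a function
   [M -> 'rV[R]_n], and the components of [u] in another chart [c] are obtained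
   from the differential of the transition map. *)
Definition to_chart (c : chart R n M) (p : M) (u : 'rV[R]_n) : 'rV[R]_n :=
  'd (c \o chart_inv (chart_at p)) (chart_at p p) u.

(* The value at [p] of the vector field with constant components [v] in [c]. *)
Definition coord_field (c : chart R n M) (v : 'rV[R]_n) (p : M) : 'rV[R]_n :=
  'd (chart_at p \o chart_inv c) (c p) v.

(* A field read in the chart [c], as a function on the image of [c]. *)
Definition vf_repr (c : chart R n M) (X : M -> 'rV[R]_n)
    (y : 'rV[R]_n) : 'rV[R]_n :=
  to_chart c (chart_inv c y) (X (chart_inv c y)).

Definition smooth_fun (f : M -> R) : Prop :=
  forall c, atlas c -> smooth_on (chart_img c) (f \o chart_inv c).

Definition smooth_vf (X : M -> 'rV[R]_n) : Prop :=
  forall c, atlas c -> smooth_on (chart_img c) (vf_repr c X).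

Definition smooth_1form (eta : M -> {scalar 'rV[R]_n}) : Prop :=
  forall c v, atlas c -> smooth_on (chart_img c)
    ((fun p => eta p (coord_field c v p)) \o chart_inv c).

Definition smooth_11tensor (phi : M -> {linear 'rV[R]_n -> 'rV[R]_n}) : Prop :=
  forall c v, atlas c -> smooth_on (chart_img c)
    (vf_repr c (fun p => phi p (coord_field c v p))).

Definition riemannian_metric (g : M -> 'rV[R]_n -> 'rV[R]_n -> R) : Prop :=
  [/\ (forall p u, scalar (g p u)),
      (forall p u v, g p u v = g p v u),
      (forall p u, u != 0 -> 0 < g p u u) &
      (forall c u v, atlas c -> smooth_on (chart_img c)
        ((fun p => g p (coord_field c u p) (coord_field c v p))
           \o chart_inv c))].

(* The function X f. *)
Definition vf_deriv (X : M -> 'rV[R]_n) (f : M -> R) (p : M) : R :=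
  'd (f \o chart_inv (chart_at p)) (chart_at p p) (X p).

(* [X, Y] = DY(X) - DX(Y) in local coordinates; evaluated at [p] in the chart
   [chart_at p], in which X has the value [X p] at [p]. *)
Definition lie_bracket (X Y : M -> 'rV[R]_n) (p : M) : 'rV[R]_n :=
  let c := chart_at p in
  'd (vf_repr c Y) (c p) (X p) - 'd (vf_repr c X) (c p) (Y p).

(* [nabla X Y] is only constrained for smooth [X] and [Y]. *)
Definition affine_connection
    (nabla : (M -> 'rV[R]_n) -> (M -> 'rV[R]_n) -> M -> 'rV[R]_n) : Prop :=
  [/\ (forall X Y, smooth_vf X -> smooth_vf Y -> smooth_vf (nabla X Y)),
      (forall X X' Y, smooth_vf X -> smooth_vf X' -> smooth_vf Y ->
        forall p, nabla (fun q => X q + X' q) Y p = nabla X Y p + nabla X' Y p),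
      (forall f X Y, smooth_fun f -> smooth_vf X -> smooth_vf Y ->
        forall p, nabla (fun q => f q *: X q) Y p = f p *: nabla X Y p),
      (forall X Y Y', smooth_vf X -> smooth_vf Y -> smooth_vf Y' ->
        forall p, nabla X (fun q => Y q + Y' q) p = nabla X Y p + nabla X Y' p) &
      (forall f X Y, smooth_fun f -> smooth_vf X -> smooth_vf Y ->
        forall p, nabla X (fun q => f q *: Y q) p
                  = vf_deriv X f p *: Y p + f p *: nabla X Y p)].

Definition levi_civita (g : M -> 'rV[R]_n -> 'rV[R]_n -> R)
    (nabla : (M -> 'rV[R]_n) -> (M -> 'rV[R]_n) -> M -> 'rV[R]_n) : Prop :=
  [/\ affine_connection nabla,
      (forall X Y, smooth_vf X -> smooth_vf Y ->
        forall p, nabla X Y p - nabla Y X p = lie_bracket X Y p) &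
      (forall X Y Z, smooth_vf X -> smooth_vf Y -> smooth_vf Z ->
        forall p, vf_deriv X (fun q => g q (Y q) (Z q)) p
                  = g p (nabla X Y p) (Z p) + g p (Y p) (nabla X Z p))].

(* The algebraic identities are tensorial, hence stated for tangent vectors. *)
Record almost_contact_metric (phi : M -> {linear 'rV[R]_n -> 'rV[R]_n})
    (xi : M -> 'rV[R]_n) (eta : M -> {scalar 'rV[R]_n})
    (g : M -> 'rV[R]_n -> 'rV[R]_n -> R) : Prop := AlmostContactMetric {
  acm_phi_smooth : smooth_11tensor phi;
  acm_xi_smooth : smooth_vf xi;
  acm_eta_smooth : smooth_1form eta;
  acm_metric : riemannian_metric g;
  acm_phi2 : forall p u, phi p (phi p u) = - u + eta p u *: xi p;
  acm_phi_xi : forall p, phi p (xi p) = 0;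
  acm_eta_phi : forall p u, eta p (phi p u) = 0;
  acm_eta_xi : forall p, eta p (xi p) = 1;
  acm_compat : forall p u v,
    g p (phi p u) (phi p v) = g p u v - eta p u * eta p v;
  acm_skew : forall p u v, g p (phi p u) v + g p u (phi p v) = 0;
  acm_eta_dual : forall p u, eta p u = g p u (xi p) }.

(* The existential denotes the Levi-Civita connection of [g], which exists and
   is unique on smooth fields;
   (nabla_X phi) Y = nabla_X (phi Y) - phi (nabla_X Y). *)
Definition kenmotsu (phi : M -> {linear 'rV[R]_n -> 'rV[R]_n})
    (xi : M -> 'rV[R]_n) (eta : M -> {scalar 'rV[R]_n})
    (g : M -> 'rV[R]_n -> 'rV[R]_n -> R) : Prop :=
  almost_contact_metric phi xi eta g /\
  exists nabla, levi_civita g nabla /\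
    forall X Y, smooth_vf X -> smooth_vf Y ->
      forall p, nabla X (fun q => phi q (Y q)) p - phi p (nabla X Y p)
                = g p (phi p (X p)) (Y p) *: xi p - eta p (Y p) *: phi p (X p).

End Fields.

Section Maps.
Context (R : realType) (m n : nat) (M : manifold R m) (N : manifold R n).

Definition smooth_map (F : M -> N) : Prop :=
  continuous F /\
  forall c d, atlas c -> atlas d ->
    smooth_on (c @` (chart_dom c `&` F @^-1` chart_dom d))
              (d \o F \o chart_inv c).

(* F in the charts chosen at [p] and at [F p]. *)
Definition map_repr (F : M -> N) (p : M) : 'rV[R]_m -> 'rV[R]_n :=
  chart_at (F p) \o F \o chart_inv (chart_at p).

(* The differential F_* at [p]. *)
Definition tangent_map (F : M -> N) (p : M) (u : 'rV[R]_m) : 'rV[R]_n :=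
  'd (map_repr F p) (chart_at p p) u.

Definition vertical (F : M -> N) (p : M) (u : 'rV[R]_m) : Prop :=
  tangent_map F p u = 0.

Definition horizontal (gM : M -> 'rV[R]_m -> 'rV[R]_m -> R)
    (F : M -> N) (p : M) (u : 'rV[R]_m) : Prop :=
  forall w, vertical F p w -> gM p u w = 0.

(* Maximal rank for a submersion is rank [n], the dimension of the target;
   equality of the squared lengths is equality of the lengths. *)
Definition riemannian_submersion (gM : M -> 'rV[R]_m -> 'rV[R]_m -> R)
    (gN : N -> 'rV[R]_n -> 'rV[R]_n -> R) (F : M -> N) : Prop :=
  [/\ smooth_map F,
      (forall q, exists p, F p = q),
      (forall p, \rank (jacobian (map_repr F p) (chart_at p p)) = n) &
      (forall p u, horizontal gM F p u ->
        gN (F p) (tangent_map F p u) (tangent_map F p u) = gM p u u)].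

Definition vertical_vf (F : M -> N) (X : M -> 'rV[R]_m) : Prop :=
  forall p, vertical F p (X p).

End Maps.

(* Main.v *)
From HB Require Import structures.
Require Import Defs.
From mathcomp Require Import all_boot all_order all_algebra.
From mathcomp Require Import all_classical all_reals all_analysis.
From mathcomp Require Import ring lra.
Import Order.TTheory GRing.Theory Num.Theory.
Import numFieldNormedType.Exports.
Local Open Scope classical_set_scope.
Local Open Scope ring_scope.
Set Implicit Arguments.
Unset Strict Implicit.
Unset Printing Implicit Defensive.

(** Both structures compute the same number, the derivative along [xi] of the
    squared length of a field, and they disagree.

    Fix a point [p] and a horizontal vector [v] at [p], nonzero because the
    target has positive dimension.  Let [c] be the chosen chart at [p], and let
    [L y] be the squared length at [y] of the field with constant components
    [v] in [c] ([coord_length2]).  The two sides evaluate the derivative of [L]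
    at [p] in the direction [xi p].

    On the Kenmotsu side, putting [Y := xi] in the defining identity gives
    [nabla_X xi = X - eta(X) xi].  Metric compatibility and vanishing torsion
    turn this into [xi g(X,X) = 2 g([xi,X],X) + 2 (g(X,X) - eta(X)^2)]: the flow
    of [xi] expands all directions orthogonal to [xi].  For the constant field
    the bracket is [- DXi(v)], where [Xi] is [xi] read in [c], so
    [DL(xi) = - 2 g(DXi(v),v) + 2 (g(v,v) - eta(v)^2)]
    ([kenmotsu_vertical_derivative]).

    On the submersion side, [xi] being vertical, the flow of [xi] preserves
    the pulled back form [h = F^* gN], and [h <= gM] with equality on horizontal
    vectors.  Hence [L - h(v,v)] has a local minimum at [p], and [L] can be
    replaced by [h(v,v)] in the derivative.  Write [f] for [F] read in charts.
    Differentiating [Df(Xi) = 0] along [v] and using the symmetry of the second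
    derivative of [f] gives [D(Df(v))(xi) = - Df(DXi(v))], and therefore
    [DL(xi) = - 2 h(DXi(v),v) = - 2 g(DXi(v),v)]
    ([submersion_vertical_derivative]).  Comparing [L] with [h(v,v)] at a
    minimum dispenses with the extension of [v] to a horizontal field.

    Since [v] is horizontal and [xi] vertical, [eta(v) = g(v,xi) = 0], so the
    difference of the two formulas is [2 g(v,v) = 0], which is absurd.

    A connection acts on global smooth fields only, so [v] has to be extended
    to the whole manifold ([extend_coord_field]); this is what the calculus of
    [C^k] maps and the bump functions are for. *)

(** * Functions of class C^k *)

Section Calculus.
Context {R : realType}.
Implicit Types U V W : normedModType R.

Lemma diff_near_eq U V (f g : U -> V) x : (\near x, f x = g x) ->
  differentiable f x ->
  differentiable g x /\ 'd g x = 'd f x :> (U -> V).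
Proof.
move=> fg df.
have gx : f x = g x by apply: nbhs_singleton fg.
have e : g \o shift x = cst (g x) + 'd f x +o_ (0 : U) id.
  have /eqaddoP fE := diff_locally df.
  apply/eqaddoP => e e0; have := fE e e0.
  have fg0 : \forall h \near (0 : U), f (h + x) = g (h + x).
    have := fg; rewrite (near_shift 0 x) => h0.
    by apply: filterS h0 => h; rewrite /= subr0.
  apply: filterS2 fg0 => h fgh.
  by rewrite /= !fctE /= fgh gx.
have dg := diff_unique (diff_continuous df) e.
split => //; apply/diff_locallyP; split; last by rewrite dg.
by rewrite dg; exact: diff_continuous.
Qed.

Lemma Ck_eq U V k (A : set U) (f g : U -> V) :
  open A -> {in A, f =1 g} -> Ck k A f -> Ck k A g.
Proof.
move=> oA.
elim: k f g => [|k IH] f g fg.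
  move=> cf x Ax.
  have nfg : \near x, f x = g x.
    by apply: filterS (open_nbhs_nbhs (conj oA Ax)) => y /mem_set /fg.
  rewrite /prop_for /continuous_at -(nbhs_singleton nfg).
  exact: cvg_trans (near_eq_cvg nfg) (cf x Ax).
move=> [df Cdf].
have nfg x : A x -> \near x, f x = g x.
  by move=> Ax; apply: filterS (open_nbhs_nbhs (conj oA Ax)) => y /mem_set /fg.
split=> [x Ax|v].
  by have [] := diff_near_eq (nfg x Ax) (df x Ax).
apply: IH (Cdf v) => x /set_mem Ax.
exact: esym (congr1 (@^~ v) (diff_near_eq (nfg x Ax) (df x Ax)).2).
Qed.

Lemma Ck_local U V k (A : set U) (f : U -> V) :
  (forall x, A x -> exists2 B : set U, B x & Ck k B f) -> Ck k A f.
Proof.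
elim: k f => [|k IH] f H /=.
  by move=> x /H[B Bx]; apply.
split=> [x /H[B Bx [+ _]]|v]; first exact.
by apply: IH => x /H[B Bx [_ /(_ v)]]; exists B.
Qed.

Lemma CkW U V k (A : set U) (f : U -> V) : Ck k.+1 A f -> Ck k A f.
Proof.
elim: k f => [|k IH] f [df Cdf].
  by move=> x /df; exact: differentiable_continuous.
by split => // v; apply: IH; exact: Cdf.
Qed.

Lemma Ck_cst U V k (A : set U) (a : V) : Ck k A (cst a).
Proof.
elim: k a => [|k IH] a; first by move=> x _; exact: cst_continuous.
split=> [x _|v]; first exact: differentiable_cst.
suff -> : (fun x => 'd (cst a) x v) = cst (0 : V) by exact: IH.
by apply/funext => x; rewrite diff_cst.
Qed.

Lemma Ck_lin U V k (A : set U) (f : {linear U -> V}) :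
  continuous f -> Ck k A f.
Proof.
move=> cf; case: k => [|k]; first by move=> x _; exact: cf.
split=> [x _|v]; first exact: linear_differentiable.
suff -> : (fun x => 'd f x v) = cst (f v) by exact: Ck_cst.
by apply/funext => x; rewrite diff_lin.
Qed.

Lemma CkD U V k (A : set U) (f g : U -> V) : open A ->
  Ck k A f -> Ck k A g -> Ck k A (fun x => f x + g x).
Proof.
move=> oA; elim: k f g => [|k IH] f g.
  by move=> cf cg x Ax; apply: continuousD; [exact: cf|exact: cg].
move=> [df Cf] [dg Cg]; split=> [x Ax|v].
  by apply: differentiableD; [exact: df|exact: dg].
apply: Ck_eq (IH _ _ (Cf v) (Cg v)) => // x /set_mem Ax.
exact: esym (congr1 (@^~ v) (diffD (df x Ax) (dg x Ax))).
Qed.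

Lemma Ck_sum U V k (A : set U) n (f : 'I_n -> U -> V) : open A ->
  (forall i, Ck k A (f i)) -> Ck k A (fun x => \sum_i f i x).
Proof.
move=> oA; elim: n f => [|n IH] f Cf.
  by under eq_fun do rewrite big_ord0; exact: Ck_cst.
under eq_fun do rewrite big_ord_recl.
by apply: CkD => //; apply: IH => i.
Qed.

(** A product rule, from the differential of the bilinear map that scales a
    vector. *)
Lemma diff_scale U V (b : U -> R) (f : U -> V) x :
  differentiable b x -> differentiable f x ->
  differentiable (fun y => b y *: f y) x /\
  forall v, 'd (fun y => b y *: f y) x v
          = b x *: 'd f x v + 'd b x v *: f x.
Proof.
move=> db df.
have scale_bilin : bilinear_for
    (GRing.Scale.Law.clone _ _ *:%R _) (GRing.Scale.Law.clone _ _ *:%R _)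
    (fun (a : R) (w : V) => a *: w).
  split=> [w|a] c y z /=; first by rewrite scalerDl scalerA.
  by rewrite scalerDr !scalerA mulrC.
pose scaleM := bilinear_isBilinear.Build R R V V _ _ _ scale_bilin.
pose scaleB : {bilinear R -> V -> V} := HB.pack (fun (a : R) (w : V) => a *: w) scaleM.
have cB : continuous (fun p : R * V => scaleB p.1 p.2).
  by move=> p; exact: scale_continuous.
have dp := differentiable_pair db df.
have dB : differentiable (fun p => scaleB p.1 p.2) (b x, f x).
  exact: differentiable_bilin.
split=> [|v].
  exact: (differentiable_comp dp dB).
pose pr y := (b y, f y).
have E1 : 'd ((fun p => scaleB p.1 p.2) \o pr) x v
        = 'd (fun p => scaleB p.1 p.2) (b x, f x) ('d pr x v).
  have Ec := diff_comp dp dB.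
  by have := congr1 (fun h : U -> V => h v) Ec.
have E2 : 'd pr x v = ('d b x v, 'd f x v).
  by have := congr1 (fun h : U -> R * V => h v) (diff_pair db df).
rewrite [LHS]E1 E2.
by have := congr1 (fun h : R * V -> V => h ('d b x v, 'd f x v)) (diff_bilin (b x, f x) cB).
Qed.

(** This is how a cut-off function disappears from first derivatives at its
    centre. *)
Lemma diff_scale_stationary U V (b : U -> R) (f : U -> V) x v :
  differentiable b x -> differentiable f x -> b x = 1 -> 'd b x v = 0 ->
  'd (fun y => b y *: f y) x v = 'd f x v.
Proof.
move=> db df b1 b0; have [_ E] := diff_scale db df.
by rewrite [LHS]E b1 b0 scale1r scale0r addr0.
Qed.

Lemma CkZ U V k (A : set U) (b : U -> R) (f : U -> V) : open A ->
  Ck k A b -> Ck k A f -> Ck k A (fun x => b x *: f x).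
Proof.
move=> oA; elim: k b f => [|k IH] b f.
  by move=> cb cf x Ax; apply: continuousZ; [exact: cb|exact: cf].
move=> Cb Cf; have [db Cdb] := Cb; have [df Cdf] := Cf.
split=> [x Ax|v].
  by have [] := diff_scale (db x Ax) (df x Ax).
have := CkD oA (IH _ _ (CkW Cb) (Cdf v)) (IH _ _ (Cdb v) (CkW Cf)).
apply: Ck_eq => // x /set_mem Ax.
by have [_ ->] := diff_scale (db x Ax) (df x Ax).
Qed.

Lemma Ck_linear_comp U V W k (A : set U) (l : {linear V -> W}) (f : U -> V) :
  open A -> continuous l -> Ck k A f -> Ck k A (l \o f).
Proof.
move=> oA cl; elim: k f => [|k IH] f.
  by move=> cf x Ax; apply: continuous_comp; [exact: cf|exact: cl].
move=> [df Cdf]; split=> [x Ax|v].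
  apply: differentiable_comp; [exact: df|exact: linear_differentiable].
apply: Ck_eq (IH _ (Cdf v)) => // x /set_mem Ax /=.
have dl : differentiable l (f x) by exact: linear_differentiable.
by rewrite (diff_comp (df x Ax) dl) diff_lin.
Qed.

(** Evaluation of an entry, named so that it can carry a linear structure. *)
Definition coord m n (i : 'I_m) (j : 'I_n) (M : 'M[R]_(m, n)) : R := M i j.

Lemma coord_is_linear m n i j : linear (@coord m n i j : _ -> R^o).
Proof. by move=> a x y; rewrite /coord !mxE. Qed.

HB.instance Definition _ m n i j :=
  GRing.isLinear.Build R 'M[R]_(m, n) R^o _ (@coord m n i j)
    (@coord_is_linear m n i j).

Lemma Ck_coord U k (A : set U) m n (f : U -> 'M[R]_(m, n)) i j : open A ->
  Ck k A f -> Ck k A (fun x => f x i j).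
Proof.
move=> oA; apply: (@Ck_linear_comp _ _ R^o k A (coord i j : {linear _ -> R^o})) => //.
exact: coord_continuous.
Qed.

(** The chain rule moves the argument of ['d g (f x)] with [x]; expanding that
    argument in a basis of [V] writes ['d (g \o f) x v] with the fixed directions
    [e i], to which the induction on [k] applies. *)
Lemma Ck_comp_basis U V W n (e : 'I_n -> V) (c : 'I_n -> {linear V -> R^o})
    k (A : set U) (B : set V) (f : U -> V) (g : V -> W) :
  (forall i, continuous (c i)) -> (forall v, v = \sum_i c i v *: e i) ->
  open A -> (forall x, A x -> B (f x)) ->
  Ck k A f -> Ck k B g -> Ck k A (g \o f).
Proof.
move=> cc cE oA AB; elim: k g => [|k IH] g.
  move=> cf cg x Ax; apply: (continuous_comp (cf x Ax)); exact: cg (AB _ Ax).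
move=> Cf [dg Cdg]; have [df Cdf] := Cf.
split=> [x Ax|v].
  by apply: differentiable_comp; [exact: df|exact/dg/AB].
have : Ck k A (fun x => \sum_i (c i ('d f x v) : R) *: 'd g (f x) (e i)).
  apply: Ck_sum => // i; apply: CkZ => //.
    exact: (@Ck_linear_comp _ _ R^o k A (c i) (fun x => 'd f x v) oA (cc i) (Cdf v)).
  exact: (IH _ (CkW Cf) (Cdg (e i))).
apply: Ck_eq => // x /set_mem Ax /=.
rewrite (diff_comp (df x Ax) (dg _ (AB _ Ax))) /=.
by rewrite {2}(cE ('d f x v)) linear_sum; apply: eq_bigr => i _; rewrite linearZ.
Qed.

Lemma Ck_comp U W n k (A : set U) (B : set 'rV[R]_n)
    (f : U -> 'rV[R]_n) (g : 'rV[R]_n -> W) :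
  open A -> (forall x, A x -> B (f x)) ->
  Ck k A f -> Ck k B g -> Ck k A (g \o f).
Proof.
apply: (@Ck_comp_basis _ _ _ n (fun i => 'e_i) (fun i => coord 0 i)) => [i|v].
  exact: (@coord_continuous R 1 n 0 i).
exact: row_sum_delta.
Qed.

Lemma Ck_comp_real U W k (A : set U) (B : set R) (f : U -> R) (g : R -> W) :
  open A -> (forall x, A x -> B (f x)) ->
  Ck k A f -> Ck k B g -> Ck k A (g \o f).
Proof.
apply: (@Ck_comp_basis U R W 1 (fun=> 1) (fun=> (idfun : {linear R^o -> R^o}))) => [i|v].
  by move=> x.
by rewrite big_ord1 /= /GRing.scale /= mulr1.
Qed.

End Calculus.

(** * Symmetry of second derivatives and first-order conditions *)

Section SecondOrder.
Context {R : realType}.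
Implicit Types V : normedModType R.

Lemma is_derive_line V (g : V -> R) (x u : V) (s : R) :
  differentiable g (x + s *: u) ->
  is_derive s 1 (fun t => g (x + t *: u)) ('d g (x + s *: u) u).
Proof.
move=> dg.
have dl : is_diff s (fun t : R => x + t *: u) (fun t => t *: u).
  by apply: is_diff_eq; rewrite add0r.
have dc : differentiable (g \o (fun t : R => x + t *: u)) s.
  exact: differentiable_comp.
apply: DeriveDef; first exact: diff_derivable.
rewrite deriveE //.
have := congr1 (fun h : R -> R => h 1) (diff_comp (ex_diff (is_diff_def:=dl)) dg).
by rewrite /= diff_val scale1r.
Qed.

Lemma mean_value_line V (g : V -> R) (x u : V) (h : R) : 0 < h ->
  (forall s, 0 <= s <= h -> differentiable g (x + s *: u)) ->
  exists2 s, 0 <= s <= h & g (x + h *: u) - g x = h * 'd g (x + s *: u) u.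
Proof.
move=> h0 dg.
pose F t := g (x + t *: u); pose dF t := 'd g (x + t *: u) u.
have isd t : 0 <= t <= h -> is_derive t 1 F (dF t).
  by move=> /dg; exact: is_derive_line.
have [||s] := @MVT R F dF 0 h h0.
- by move=> t; rewrite in_itv /= => /andP[t0 th]; apply: isd; rewrite !ltW.
- apply: derivable_within_continuous => t; rewrite in_itv /= => th.
  by case: (isd t th).
rewrite in_itv /= => /andP[s0 sh] E; exists s; first by rewrite !ltW.
by move: E; rewrite /F /dF scale0r addr0 subr0 mulrC.
Qed.

(** Two applications of the mean value theorem, first along [u] and then along
    [v].  The left-hand side is symmetric in [u] and [v], the right-hand side is
    not: this is the source of the symmetry of second derivatives. *)
Lemma second_difference V (A : set V) (f : V -> R) (x u v : V) :
  nbhs x A -> (forall y, A y -> differentiable f y) ->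
  (forall y, A y -> differentiable (fun z => 'd f z u) y) ->
  \forall h \near (0 : R)^'+, exists2 y, A y &
    f (x + h *: u + h *: v) - f (x + h *: u) - (f (x + h *: v) - f x)
    = h ^+ 2 * 'd (fun z => 'd f z u) y v.
Proof.
move=> nA df ddf.
have [r /= r0 rA] : exists2 r : R, 0 < r & ball x r `<=` A.
  by move/nbhs_ballP : nA => [r r0 rA]; exists r.
near=> h.
have h0 : 0 < h by near: h; exact: nbhs_right_gt.
(* The summand [1] keeps the divisor positive when [u] and [v] vanish. *)
have hr : h * (`|u| + `|v| + 1) < r.
  rewrite -ltr_pdivlMr ?ltr_wpDl ?addr_ge0 //.
  by near: h; apply: nbhs_right_lt; rewrite divr_gt0 ?ltr_wpDl ?addr_ge0.
have inA s t : 0 <= s <= h -> 0 <= t <= h -> A (x + s *: u + t *: v).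
  move=> /andP[s0 sh] /andP[t0 th]; apply: rA.
  rewrite -ball_normE /= -!addrA opprD addrA subrr add0r normrN.
  apply: le_lt_trans hr; apply: le_trans (ler_normD _ _) _.
  rewrite !normrZ !ger0_norm // !mulrDr mulr1.
  have a0 : s * `|u| <= h * `|u| by rewrite ler_wpM2r.
  have b0 : t * `|v| <= h * `|v| by rewrite ler_wpM2r.
  lra.
have zh : 0 <= (0 : R) <= h by rewrite lexx ltW.
have hh : 0 <= h <= h by rewrite lexx ltW.
pose g y := f (y + h *: v) - f y.
have dg s : 0 <= s <= h -> differentiable g (x + s *: u) /\
   'd g (x + s *: u) u = 'd f (x + s *: u + h *: v) u - 'd f (x + s *: u) u.
  move=> sh.
  have d1 : differentiable f (x + s *: u).
    by apply: df; have := inA _ _ sh zh; rewrite scale0r addr0.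
  have d2 : differentiable f (x + s *: u + h *: v) by apply: df; exact: inA.
  have ds : is_diff (x + s *: u) (fun y : V => y + h *: v) (fun y => y).
    by apply: is_diff_eq; rewrite addr0.
  have d3 : differentiable (f \o (fun y : V => y + h *: v)) (x + s *: u).
    exact: differentiable_comp.
  split; first exact: (differentiableB d3 d1).
  have := congr1 (fun l : V -> R => l u) (diffB d3 d1).
  have := congr1 (fun l : V -> R => l u) (diff_comp (ex_diff (is_diff_def:=ds)) d2).
  by rewrite /= diff_val => -> ->.
have [s sh E] := mean_value_line h0 (fun s sh => (dg s sh).1).
have [t th E'] := @mean_value_line V (fun z => 'd f z u) (x + s *: u) v h h0
  (fun t th => ddf _ (inA _ _ sh th)).
exists (x + s *: u + t *: v); first exact: inA.
rewrite -/(g (x + h *: u)) -/(g x) E (dg s sh).2 E'.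
by rewrite mulrA expr2.
Unshelve. all: by end_near. Qed.

Lemma diff2_sym V (A : set V) (f : V -> R) (x u v : V) :
  open A -> A x -> Ck 2 A f ->
  'd (fun y => 'd f y u) x v = 'd (fun y => 'd f y v) x u.
Proof.
move=> oA Ax [df Cf].
have ddf w y : A y -> differentiable (fun z => 'd f z w) y by have [+ _] := Cf w; exact.
have cdf w1 w2 : {for x, continuous (fun y => 'd (fun z => 'd f z w1) y w2)}.
  by have [_ /(_ w2)] := Cf w1; apply.
apply/eqP; rewrite -subr_eq0 -normr_le0; apply/ler_addgt0Pl => e e0; rewrite addr0.
have e2 : 0 < e / 2 by rewrite divr_gt0.
pose N w1 w2 := A `&` [set y | `|'d (fun z => 'd f z w1) x w2
                                - 'd (fun z => 'd f z w1) y w2| < e / 2].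
have nN w1 w2 : nbhs x (N w1 w2).
  apply: filterI; first exact: open_nbhs_nbhs.
  by have /cvgr_dist_lt /(_ _ e2) := cdf w1 w2.
have sd w1 w2 := @second_difference V (N w1 w2) f x w1 w2 (nN w1 w2)
  (fun y Ny => df y Ny.1) (fun y Ny => ddf w1 y Ny.1).
near (0 : R)^'+ => h.
have h0 : 0 < h by near: h; exact: nbhs_right_gt.
(* A single small [h] serves both orders, and the two intermediate points [y]
   and [z] give second derivatives within [e / 2] of those at [x]. *)
have [y [_ Ny] Ey] : exists2 y, N u v y &
    f (x + h *: u + h *: v) - f (x + h *: u) - (f (x + h *: v) - f x)
    = h ^+ 2 * 'd (fun z => 'd f z u) y v by near: h; exact: sd.
have [z [_ Nz] Ez] : exists2 y, N v u y &
    f (x + h *: v + h *: u) - f (x + h *: v) - (f (x + h *: u) - f x)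
    = h ^+ 2 * 'd (fun z => 'd f z v) y u by near: h; exact: sd.
have Eyz : 'd (fun z => 'd f z u) y v = 'd (fun z => 'd f z v) z u.
  apply: (@mulfI _ (h ^+ 2)); first by rewrite expf_neq0 ?gt_eqF.
  by rewrite -Ey -Ez (addrAC x (h *: v)); ring.
rewrite /= in Ny Nz; rewrite Eyz in Ny; rewrite distrC in Nz.
rewrite [leRHS]splitr.
rewrite -(subrKA ('d (fun z => 'd f z v) z u)).
by apply: le_trans (ler_normD _ _) _; rewrite lerD // ltW.
Unshelve. all: by end_near. Qed.

Lemma diff_at_min V (f : V -> R) (x w : V) : differentiable f x ->
  (\forall y \near x, f x <= f y) -> 'd f x w = 0.
Proof.
move=> df fmin.
(* It suffices to bound the differential below in every direction, for it can
   then be applied to [w] and [- w]. *)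
suff ge0 u : 0 <= 'd f x u.
  by apply/eqP; rewrite eq_le ge0 andbT -oppr_ge0 -linearN ge0.
rewrite leNgt; apply/negP => L0.
have : (fun h => h^-1 *: ((f \o shift x) (h *: u) - f x)) @ (0 : R)^' --> 'd f x u.
  rewrite -deriveE //; exact: diff_derivable.
move=> /cvgr_lt /(_ _ L0); rewrite near_withinE => q0.
have cl : (fun h : R => h *: u + x) @ (0 : R) --> x.
  rewrite -[X in _ --> X]add0r -[X in _ --> X + _](scale0r u).
  by apply: cvgD; [exact: scalel_continuous|exact: cvg_cst].
have m0 := cl _ fmin.
near (0 : R)^'+ => h.
have h0 : 0 < h by near: h; exact: nbhs_right_gt.
have qh : h != 0 -> h^-1 *: ((f \o shift x) (h *: u) - f x) < 0.
  by near: h; apply: cvg_within; exact: q0.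
have mh : f x <= f (h *: u + x).
  by near: h; apply: cvg_within; exact: m0.
have := qh (lt0r_neq0 h0).
by rewrite pmulr_rlt0 ?invr_gt0 //= subr_lt0 ltNge mh.
Unshelve. all: by end_near. Qed.

End SecondOrder.

(** * Orthogonal complements of kernels *)

Section InnerProduct.
Context {R : realType} (m : nat).
Variable g : 'rV[R]_m -> 'rV[R]_m -> R.
Hypothesis g_lin : forall u, scalar (g u).
Hypothesis g_sym : forall u v, g u v = g v u.
Hypothesis g_pos : forall u, u != 0 -> 0 < g u u.

Lemma innerDr u v w : g u (v + w) = g u v + g u w.
Proof. by have := g_lin u 1 v w; rewrite scale1r mul1r. Qed.

Lemma inner0r u : g u 0 = 0.
Proof. by have := innerDr u 0 0; rewrite addr0 => /esym/eqP; rewrite -subr_eq0 addrK => /eqP. Qed.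

Lemma innerZr u a v : g u (a *: v) = a * g u v.
Proof. by have := g_lin u a v 0; rewrite !addr0 inner0r addr0. Qed.

Lemma innerDl u v w : g (v + w) u = g v u + g w u.
Proof. by rewrite g_sym innerDr !(g_sym u). Qed.

Lemma innerZl u a v : g (a *: v) u = a * g v u.
Proof. by rewrite g_sym innerZr g_sym. Qed.

Lemma innerNl u v : g (- v) u = - g v u.
Proof. by rewrite -scaleN1r innerZl mulN1r. Qed.

Lemma inner_sumr n u (F : 'I_n -> 'rV[R]_m) : g u (\sum_i F i) = \sum_i g u (F i).
Proof.
elim: n F => [|n IH] F; first by rewrite !big_ord0 inner0r.
by rewrite !big_ord_recl innerDr IH.
Qed.

Lemma inner_basis u v : g u v = \sum_i \sum_j u 0 i * v 0 j * g 'e_i 'e_j.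
Proof.
rewrite {1}(row_sum_delta u) g_sym inner_sumr; apply: eq_bigr => i _.
rewrite innerZr g_sym {1}(row_sum_delta v) inner_sumr mulr_sumr.
by apply: eq_bigr => j _; rewrite innerZr mulrA.
Qed.

Definition gram : 'M[R]_m := \matrix_(i, j) g 'e_i 'e_j.

Lemma gramE u v : g u v = (u *m gram *m v^T) 0 0.
Proof.
rewrite inner_basis exchange_big mxE; apply: eq_bigr => j _ /=.
rewrite !mxE mulr_suml; apply: eq_bigr => i _.
by rewrite !mxE mulrAC.
Qed.

(** A Gram matrix of independent vectors is invertible, so the orthogonality
    conditions that define the projection to the kernel can be solved. *)
Lemma orthogonal_projection_ker n (T : {linear 'rV[R]_m -> 'rV[R]_n}) u :
  exists2 w, T w = 0 & forall z, T z = 0 -> g (u - w) z = 0.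
Proof.
pose S := row_base (kermx (lin1_mx T)).
have kerS z : (T z = 0) <-> exists y, z = y *m S.
  split=> [Tz|[y ->]].
    have : (z <= kermx (lin1_mx T))%MS by apply/sub_kermxP; rewrite mul_rV_lin1.
    by rewrite -(eq_row_base (kermx _)) => /submxP[y ->]; exists y.
  have : (y *m S <= kermx (lin1_mx T))%MS.
    by rewrite -(eq_row_base (kermx _)) submxMl.
  by move/sub_kermxP; rewrite mul_rV_lin1.
pose Q := S *m gram *m S^T.
have uQ : Q \in unitmx.
  rewrite -row_free_unit -kermx_eq0; apply/eqP/row_matrixP => i.
  rewrite row0; set y := row i _.
  have yQ : y *m Q = 0 by apply/sub_kermxP; exact: row_sub.
  have yS : y *m S = 0.
    apply/eqP/negP => /negP /g_pos; rewrite gramE (trmx_mul y).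
    have -> : y *m S *m gram *m (S^T *m y^T) = y *m Q *m y^T.
      by rewrite /Q !mulmxA.
    by rewrite yQ mul0mx mxE ltxx.
  by apply: (row_free_inj (row_base_free _)); rewrite yS mul0mx.
exists (u *m gram *m S^T *m invmx Q *m S); first by apply/kerS; eexists.
move=> z /kerS[y ->]; rewrite gramE (trmx_mul y).
set X := u *m gram *m S^T.
suff XQ : (u - X *m invmx Q *m S) *m gram *m S^T = 0.
  by rewrite (mulmxA _ S^T) XQ mul0mx mxE.
have SGS : S *m (gram *m S^T) = Q by rewrite mulmxA.
by rewrite -mulmxA mulmxBl mulmxA -/X -(mulmxA _ S) SGS mulmxKV // subrr.
Qed.

End InnerProduct.

(** * Derivatives of sums, of rows and of quadratic forms *)

Section SumsAndRows.
Context {R : realType}.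
Implicit Types U V : normedModType R.

Lemma linear_row n (W : lmodType R) (l : {linear 'rV[R]_n -> W}) u :
  l u = \sum_i u 0 i *: l 'e_i.
Proof.
by rewrite {1}(row_sum_delta u) linear_sum; apply: eq_bigr => i _; rewrite linearZ.
Qed.

Lemma diff_sum U V n (f : 'I_n -> U -> V) x :
  (forall i, differentiable (f i) x) ->
  differentiable (fun y => \sum_i f i y) x /\
  forall v, 'd (fun y => \sum_i f i y) x v = \sum_i 'd (f i) x v.
Proof.
elim: n f => [|n IH] f df.
  have -> : (fun y => \sum_(i < 0) f i y) = cst 0.
    by apply/funext => y; rewrite big_ord0.
  split=> [|v]; first exact: differentiable_cst.
  by rewrite big_ord0 diff_cst.
have [dS SE] := IH (fun i => f (lift ord0 i)) (fun i => df _).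
have -> : (fun y => \sum_(i < n.+1) f i y)
        = f ord0 + (fun y => \sum_(i < n) f (lift ord0 i) y).
  by apply/funext => y; rewrite big_ord_recl.
split=> [|v]; first exact: differentiableD.
rewrite big_ord_recl -SE.
exact: (congr1 (fun h : U -> V => h v) (diffD (df ord0) dS)).
Qed.

Lemma diff_coord U n (f : U -> 'rV[R]_n) x i : differentiable f x ->
  differentiable (fun y => f y 0 i) x /\
  forall v, 'd (fun y => f y 0 i) x v = 'd f x v 0 i.
Proof.
move=> df.
have cc : continuous (coord 0 i : 'rV[R]_n -> R^o) by exact: coord_continuous.
have dc : differentiable (coord 0 i : 'rV[R]_n -> R^o) (f x).
  exact: linear_differentiable.
split=> [|v]; first exact: (differentiable_comp df dc).
have := congr1 (fun h : U -> R^o => h v) (diff_comp df dc).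
have := congr1 (fun h : 'rV[R]_n -> R^o => h ('d f x v)) (diff_lin (f x) cc).
by move=> /= E1 E2; rewrite [LHS]E2 [LHS]E1.
Qed.

Lemma diff2_sym_row U n (A : set U) (f : U -> 'rV[R]_n) (x u v : U) :
  open A -> A x -> Ck 2 A f ->
  'd (fun y => 'd f y u) x v = 'd (fun y => 'd f y v) x u.
Proof.
move=> oA Ax Cf; have [df Cdf] := Cf.
apply/rowP => i.
have E w w' : 'd (fun y => 'd f y w) x w' 0 i =
              'd (fun y => 'd (fun z => f z 0 i) y w) x w'.
  have [dw _] := Cdf w.
  have [d1 E1] := diff_coord i (dw x Ax).
  rewrite -E1.
  have E2 : \forall y \near x, 'd f y w 0 i = 'd (fun z => f z 0 i) y w.
    apply: filterS (open_nbhs_nbhs (conj oA Ax)) => y Ay.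
    exact: esym ((diff_coord i (df y Ay)).2 w).
  exact: esym (congr1 (fun h : U -> R => h w') (diff_near_eq E2 d1).2).
rewrite !E; apply: (diff2_sym _ _ oA Ax).
exact: Ck_coord.
Qed.

(** Differentiating ['d f y (w y) = 0] along [v] produces the second derivative of
    [f] along [w x] and [v], in the order opposite to the one on the left; the
    symmetry exchanges them. *)
Lemma diff_annihilated_field m n (A : set 'rV[R]_m)
    (f : 'rV[R]_m -> 'rV[R]_n) (w : 'rV[R]_m -> 'rV[R]_m) x v :
  open A -> A x -> Ck 2 A f -> differentiable w x ->
  (\forall y \near x, 'd f y (w y) = 0) ->
  'd (fun y => 'd f y v) x (w x) = - 'd f x ('d w x v).
Proof.
move=> oA Ax Cf dw w0; have [df Cdf] := Cf.
have ddf i : differentiable (fun y => 'd f y 'e_i) x.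
  by have [+ _] := Cdf 'e_i; exact.
(* Summands of ['d f y (w y)] with the directions of differentiation fixed. *)
pose s i y := w y 0 i *: 'd f y 'e_i.
have ds i : differentiable (s i) x /\ forall u, 'd (s i) x u =
    w x 0 i *: 'd (fun y => 'd f y 'e_i) x u + 'd w x u 0 i *: 'd f x 'e_i.
  have [d1 E1] := diff_coord i dw.
  have [d2 E2] := diff_scale d1 (ddf i).
  split; first exact: d2.
  by move=> u; rewrite [LHS]E2 E1.
have [dS SE] := diff_sum (fun i => (ds i).1).
have S0 : \forall y \near x, (fun y => \sum_i s i y) y = cst 0 y.
  by apply: filterS w0 => y; rewrite linear_row.
have [_ c0] := diff_near_eq S0 dS.
pose ev (h : 'rV[R]_m -> 'rV[R]_n) := h v.
have sum0 : \sum_i 'd (s i) x v = 0.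
  apply: etrans (esym (SE v)) _; apply: etrans (esym (congr1 ev c0)) _.
  exact: (congr1 ev (diff_cst (0 : 'rV[R]_n) x)).
have E i : 'd (s i) x v = w x 0 i *: 'd (fun y => 'd f y v) x 'e_i
                        + 'd w x v 0 i *: 'd f x 'e_i.
  apply: etrans ((ds i).2 v) _; congr (_ *: _ + _).
  exact: (diff2_sym_row _ _ oA Ax Cf).
apply/eqP; rewrite -addr_eq0; apply/eqP.
have L1 := linear_row ('d (fun y => 'd f y v) x) (w x).
have L2 := linear_row ('d f x) ('d w x v).
apply: etrans (congr2 +%R L1 L2) _; apply: etrans _ sum0.
apply: esym; apply: etrans (eq_bigr _ (fun i _ => E i)) _; exact: big_split.
Qed.

(** The entries of [G] do not vary to first order in the direction [w], so only
    the two occurrences of [a] contribute, equally by symmetry. *)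
Lemma diff_quadratic U n (G : U -> 'rV[R]_n -> 'rV[R]_n -> R)
    (a : U -> 'rV[R]_n) x w :
  (forall y u, scalar (G y u)) -> (forall y u v, G y u v = G y v u) ->
  (forall i j, differentiable (fun y => G y 'e_i 'e_j) x) ->
  (forall i j, 'd (fun y => G y 'e_i 'e_j) x w = 0) ->
  differentiable a x ->
  differentiable (fun y => G y (a y) (a y)) x /\
  'd (fun y => G y (a y) (a y)) x w = 2 * G x ('d a x w) (a x).
Proof.
move=> Glin Gsym dG G0 da.
pose t i j y := a y 0 i *: (a y 0 j *: G y 'e_i 'e_j).
have dt i j : differentiable (t i j) x /\ 'd (t i j) x w =
    a x 0 i * 'd a x w 0 j * G x 'e_i 'e_j + 'd a x w 0 i * a x 0 j * G x 'e_i 'e_j.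
  have [di Ei] := diff_coord i da; have [dj Ej] := diff_coord j da.
  have [d1 E1] := diff_scale dj (dG i j).
  have [d2 E2] := diff_scale di d1.
  split; first exact: d2.
  rewrite [LHS]E2 E1 Ei Ej G0 scaler0 add0r.
  by rewrite /GRing.scale /= !mulrA.
have dti i := diff_sum (fun j => (dt i j).1).
have [dS SE] := diff_sum (fun i => (dti i).1).
have -> : (fun y => G y (a y) (a y)) = (fun y => \sum_i \sum_j t i j y).
  apply/funext => y; rewrite (inner_basis (Glin y) (Gsym y)).
  by apply: eq_bigr => i _; apply: eq_bigr => j _; rewrite /t /GRing.scale /= mulrA.
split; first exact: dS.
rewrite [LHS]SE.
have E i : 'd (fun y => \sum_j t i j y) x w =
    \sum_j a x 0 i * 'd a x w 0 j * G x 'e_i 'e_j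
    + \sum_j 'd a x w 0 i * a x 0 j * G x 'e_i 'e_j.
  apply: etrans ((dti i).2 w) _.
  by rewrite (eq_bigr _ (fun j _ => (dt i j).2)) big_split.
rewrite (eq_bigr _ (fun i _ => E i)) big_split /=.
rewrite -!(inner_basis (Glin x) (Gsym x)).
by rewrite (Gsym x (a x)); ring.
Qed.

End SumsAndRows.

(** * Bump functions *)

Section Bump.
Context {R : realType}.

(** The function [exp(-1/t)] and its multiples by powers of [1/t], extended by
    zero: a family whose span is closed under differentiation, which makes smoothness an induction. *)
Definition flat (j : nat) (t : R) : R :=
  if 0 < t then t^-1 ^+ j * expR (- t^-1) else 0.

Lemma flat_le0 j t : t <= 0 -> flat j t = 0.
Proof. by rewrite /flat leNgt => /negbTE ->. Qed.

(** The quadratic bound gives continuity and a zero derivative at the origin.  It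
    comes from [s^(j+2) / (j+2)! <= exp(s)] with [s = 1/t]. *)
Lemma flat_bound j t : `|flat j t| <= (j.+2)`!%:R * t ^+ 2.
Proof.
have [t0|t0] := ltP 0 t; last first.
  by rewrite flat_le0 // normr0 mulr_ge0 // sqr_ge0.
have [s s0 ts] : exists2 s, 0 < s & t = s^-1.
  by exists t^-1; rewrite ?invr_gt0 // invrK.
have s0' := ltW s0.
rewrite /flat t0 ts invrK ger0_norm ?mulr_ge0 ?expR_ge0 ?exprn_ge0 //.
have := expR_ge1Dxn j.+1 s0'.
move=> H; rewrite expRN ler_pdivrMr ?expR_gt0 // exprVn.
have f0 : 0 < (j.+2)`!%:R :> R by rewrite ltr0n fact_gt0.
have H2 : s ^+ j.+2 / (j.+2)`!%:R <= expR s by apply: le_trans H; rewrite lerDr.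
rewrite ler_pdivrMr // in H2.
have -> : s ^+ j = s ^- 2 * s ^+ j.+2.
  by rewrite -(addn2 j) exprD mulrCA mulVf ?mulr1 // expf_neq0 ?gt_eqF.
rewrite mulrAC [leRHS]mulrC ler_wpM2l ?invr_ge0 ?exprn_ge0 //.
by rewrite mulrC.
Qed.

Lemma is_derive_flat j (t : R) :
  is_derive t 1 (flat j) (flat j.+2 t - j%:R * flat j.+1 t).
Proof.
have [t0|t0|<-] := ltgtP 0 t.
- have E : {near t, (fun x : R => x^-1 ^+ j * expR (- x^-1)) =1 flat j}.
    near=> x; rewrite /flat; have -> // : 0 < x.
    by near: x; exact: lt_nbhsr.
  apply: near_eq_is_derive E _.
  have tn : t != 0 by rewrite gt_eqF.
  have dV : is_derive t 1 (fun x : R => x^-1) (- t ^- 2).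
    apply: DeriveDef; first exact: derivableV.
    by rewrite deriveV // derive_id; rewrite /GRing.scale /= mulr1.
  have dX := @is_deriveX _ _ _ j _ _ _ dV.
  have dN := is_deriveN dV.
  have dE := is_derive1_comp (is_derive_expR _) dN.
  have dM := is_deriveM dX dE.
  have fE : (fun x : R => x^-1 ^+ j * expR (- x^-1))
          = (fun x : R => x^-1) ^+ j * (expR \o - (fun x : R => x^-1)).
    by apply/funext => x; rewrite !fctE.
  rewrite fE; apply: (is_derive_eq dM).
  rewrite /flat t0 !fctE /= /GRing.scale /= !exprS.
  case: j {dX dM fE} => [|j]; rewrite ?expr0 ?exprS /=; by field.
- have E : {near t, cst (0 : R) =1 flat j}.
    near=> x; rewrite flat_le0 //.
    by near: x; apply: filterS (lt_nbhsl t0) => y /ltW.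
  rewrite !flat_le0 ?ltW // mulr0 subr0.
  apply: near_eq_is_derive E _.
- rewrite !(flat_le0 _ (lexx 0)) mulr0 subr0.
  have H : (fun h : R => h^-1 *: ((flat j \o shift 0) (h *: (1 : R)) - flat j 0)) @ 0^' --> (0 : R).
    apply/cvgr0Pnorm_lt => e e0.
    have d0 : 0 < (j.+2)`!%:R^-1 * e by rewrite mulr_gt0 // invr_gt0 ltr0n fact_gt0.
    rewrite near_withinE; near=> h => h0.
    rewrite /= addr0 (flat_le0 j (lexx 0)) subr0 [h *: 1]mulr1.
    rewrite [_ *: _]/(_ * _) normrM normfV.
    rewrite mulrC ltr_pdivrMr ?normr_gt0 //.
    apply: le_lt_trans (flat_bound j h) _.
    rewrite -(real_normK (num_real h)) expr2 mulrA ltr_pM2r ?normr_gt0 //.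
    rewrite -ltr_pdivlMl ?ltr0n ?fact_gt0 //.
  by apply: DeriveDef; [apply/cvg_ex; exists 0|apply/cvg_lim].
Unshelve. all: by end_near. Qed.

Lemma Ck_flat k j : Ck k [set: R] (flat j).
Proof.
have dflat i x : differentiable (flat i) x.
  by apply/derivable1_diffP; case: (is_derive_flat i x).
elim: k j => [|k IH] j; first by move=> x _; exact: differentiable_continuous.
split=> [x _|v]; first exact: dflat.
have : Ck k [set: R] (fun x => v *: (flat j.+2 x + (- j%:R) *: flat j.+1 x)).
  apply: CkZ; [exact: openT|exact: Ck_cst|].
  apply: CkD; [exact: openT|exact: IH|].
  by apply: CkZ; [exact: openT|exact: Ck_cst|exact: IH].
apply: Ck_eq; first exact: openT.
move=> x _; case: (is_derive_flat j x) => dx Dx.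
rewrite deriv1E // derive1E Dx.
by rewrite /GRing.scale /= mulNr.
Qed.

Lemma flat0_mono (s t : R) : s <= t -> flat 0 s <= flat 0 t.
Proof.
move=> st; have [s0|s0] := leP s 0.
  by rewrite flat_le0 // /flat; case: ifP => // _; rewrite mul1r expR_ge0.
have t0 := lt_le_trans s0 st.
by rewrite /flat s0 t0 !mul1r ler_expR lerN2 lef_pV2 ?posrE.
Qed.

(** The bump is [exp(-1/t)] at [t = r^2 - |y - x0|^2] for the Euclidean norm,
    normalised at the centre.  The statement uses the maximum norm, which is at
    most the Euclidean one.  The differential vanishes at the centre because the
    bump is maximal there. *)
Lemma bump_function n (x0 : 'rV[R]_n) (r : R) : 0 < r ->
  exists beta : 'rV[R]_n -> R,
    [/\ smooth_on [set: 'rV[R]_n] beta, beta x0 = 1,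
        (forall w, 'd beta x0 w = 0) &
        (forall y, r <= `|y - x0| -> beta y = 0)].
Proof.
move=> r0.
pose sq (y : 'rV[R]_n) := \sum_i (y 0 i - x0 0 i) *: (y 0 i - x0 0 i).
have sq0 : sq x0 = 0 by rewrite /sq big1 // => i _; rewrite subrr scaler0.
have sq_ge0 y : 0 <= sq y by apply: sumr_ge0 => i _; exact: sqr_ge0.
have Csq k : Ck k [set: 'rV[R]_n] sq.
  have Ci i : Ck k [set: 'rV[R]_n] (fun y => y 0 i - x0 0 i).
    apply: CkD; [exact: openT| |exact: Ck_cst].
    apply: Ck_coord; first exact: openT.
    by apply: (@Ck_lin R 'rV[R]_n 'rV[R]_n k _ idfun) => y.
  by apply: Ck_sum => [|i]; [exact: openT|apply: CkZ; [exact: openT| |]].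
pose s y := r ^+ 2 + (- 1) *: sq y.
have Cs k : Ck k [set: 'rV[R]_n] s.
  apply: CkD; [exact: openT|exact: Ck_cst|].
  by apply: CkZ; [exact: openT|exact: Ck_cst|].
have c0 : 0 < flat 0 (r ^+ 2).
  by rewrite /flat exprn_gt0 // expr0 mul1r expR_gt0.
pose beta y := (flat 0 (r ^+ 2))^-1 *: (flat 0 \o s) y.
have Cb k : Ck k [set: 'rV[R]_n] beta.
  apply: CkZ; [exact: openT|exact: Ck_cst|].
  by apply: (@Ck_comp_real _ _ _ _ _ [set: R]) => //; [exact: openT|exact: Ck_flat].
exists beta; split => //.
- by rewrite /beta /s /= sq0 scaler0 addr0 /GRing.scale /= mulVf ?gt_eqF.
- move=> w.
  have ci : 0 <= (flat 0 (r ^+ 2))^-1 by rewrite invr_ge0 ltW.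
  have db : differentiable beta x0 by have [+ _] := Cb 1%N; exact.
  have E := diffN db.
  have := congr1 (fun h : 'rV[R]_n -> R => h w) E.
  have -> : 'd (- beta) x0 w = 0.
    apply: diff_at_min; first exact: differentiableN.
    near=> y; rewrite !fctE lerN2 /beta /= /GRing.scale /= ler_wpM2l //.
    rewrite /s sq0 scaler0 addr0; apply: flat0_mono.
    by rewrite scaleN1r gerDl oppr_le0.
  by move/esym/eqP; rewrite oppr_eq0 => /eqP.
- move=> y ry; rewrite /beta /= [flat 0 (s y)]flat_le0 ?scaler0 // /s scaleN1r subr_le0.
  rewrite leNgt; apply/negP => sr; move: ry; rewrite leNgt => /negP; apply.
  have : ball x0 r y.
    have r0' := ltW r0.
    split=> // i j; rewrite (ord1 i) -ball_normE /= distrC.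
    rewrite -(@ltr_pXn2r _ 2) ?nnegrE // real_normK ?num_real //.
    apply: le_lt_trans sr; rewrite /sq (bigD1 j) //= expr2 lerDl.
    by apply: sumr_ge0 => k _; exact: sqr_ge0.
  by rewrite -ball_normE /= distrC.
Unshelve. all: by end_near. Qed.

End Bump.

(** * Charts, transition maps and global extensions *)

Section Charts.
Context {R : realType} {n : nat} {M : manifold R n}.
Implicit Types (c d e : chart R n M) (p q : M).

Lemma chart_inv_dom c y : chart_img c y -> chart_dom c (chart_inv c y).
Proof. by move=> [q cq <-]; rewrite chart_mapK. Qed.

Lemma chart_invK c y : chart_img c y -> c (chart_inv c y) = y.
Proof. by move=> [q cq <-]; rewrite chart_mapK. Qed.

Lemma near_chart_inv c q (A : set M) : chart_dom c q -> nbhs q A ->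
  \forall y \near c q, A (chart_inv c y).
Proof.
move=> cq qA.
have : {for c q, continuous (chart_inv c)}.
  by apply: chart_inv_continuous; exists q.
by apply; rewrite chart_mapK.
Qed.

Lemma near_chart_img c q : chart_dom c q -> \forall y \near c q, chart_img c y.
Proof.
by move=> cq; apply: open_nbhs_nbhs; split; [exact: chart_img_open|exists q].
Qed.

Lemma near_chart_dom c q : chart_dom c q -> nbhs q (chart_dom c).
Proof. by move=> cq; apply: open_nbhs_nbhs; split => //; exact: chart_dom_open. Qed.

Lemma chart_image_open c (A : set M) :
  open A -> A `<=` chart_dom c -> open (c @` A).
Proof.
move=> oA Ac; rewrite openE => _ [q Aq <-].
have cq := Ac _ Aq.
have qA : nbhs q A by exact: open_nbhs_nbhs.
apply: filterS2 (near_chart_inv cq qA) (near_chart_img cq) => y Ay cy.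
by exists (chart_inv c y) => //; exact: chart_invK.
Qed.

Lemma chart_overlap_open c (A : set M) : open A -> open (c @` (chart_dom c `&` A)).
Proof.
move=> oA; apply: chart_image_open; last by move=> q [].
by apply: openI => //; exact: chart_dom_open.
Qed.

End Charts.

Section MapInCharts.
Context {R : realType} {m n : nat} {M : manifold R m} {N : manifold R n}.
Variable F : M -> N.
Hypothesis F_smooth : smooth_map F.
Implicit Types (c : chart R m M) (d : chart R n N).

Lemma chart_preimage_open c d : open (c @` (chart_dom c `&` F @^-1` chart_dom d)).
Proof.
apply: chart_overlap_open; have [cF _] := F_smooth.
by apply: open_comp => [x _|]; [exact: cF|exact: chart_dom_open].
Qed.

Lemma map_differentiable c d q : atlas c -> atlas d ->
  chart_dom c q -> chart_dom d (F q) ->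
  differentiable (d \o F \o chart_inv c) (c q).
Proof.
move=> ac ad cq dq; have [_ sF] := F_smooth.
by have [+ _] := sF c d ac ad 1%N; apply; exists q.
Qed.

End MapInCharts.

Section ChainRule.
Context {R : realType} {l m n : nat}.
Context {L : manifold R l} {M : manifold R m} {N : manifold R n}.

Lemma smooth_idmap : smooth_map (@idfun M).
Proof.
split=> [x|c d ac ad]; first exact: cvg_id.
exact: atlas_compatible.
Qed.

(** The chain rule for maps read in charts: changing the intermediate chart is
    the case where one of the two maps is the identity. *)
Lemma chain_rule (G : L -> M) (F : M -> N) (b : chart R l L) (c : chart R m M)
    (d : chart R n N) p u : smooth_map G -> smooth_map F ->
  atlas b -> atlas c -> atlas d ->
  chart_dom b p -> chart_dom c (G p) -> chart_dom d (F (G p)) ->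
  'd (d \o (F \o G) \o chart_inv b) (b p) u =
  'd (d \o F \o chart_inv c) (c (G p)) ('d (c \o G \o chart_inv b) (b p) u).
Proof.
move=> sG sF ab ac ad bp cGp dFGp.
have dG := map_differentiable sG ab ac bp cGp.
have dF := map_differentiable sF ac ad cGp dFGp.
have eG : (c \o G \o chart_inv b) (b p) = c (G p) by rewrite /= chart_mapK.
rewrite -eG in dF *.
have E : \forall y \near b p,
    ((d \o F \o chart_inv c) \o (c \o G \o chart_inv b)) y
    = (d \o (F \o G) \o chart_inv b) y.
  have nG : nbhs p (G @^-1` chart_dom c).
    by have [cG _] := sG; apply: cG; exact: near_chart_dom.
  apply: filterS (near_chart_inv bp nG) => y cy.
  by rewrite /= chart_mapK.
have [_ ->] := diff_near_eq E (differentiable_comp dG dF).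
by rewrite diff_comp.
Qed.

End ChainRule.

Section Fields.
Context {R : realType} {n : nat} {M : manifold R n}.
Implicit Types (c d e : chart R n M) (p q : M).

Lemma transition_chain c d e q u : atlas c -> atlas d -> atlas e ->
  chart_dom c q -> chart_dom d q -> chart_dom e q ->
  'd (e \o chart_inv c) (c q) u =
  'd (e \o chart_inv d) (d q) ('d (d \o chart_inv c) (c q) u).
Proof.
move=> ac ad ae cq dq eq.
by apply: (@chain_rule R n n n M M M idfun idfun c d e q u) => //; exact: smooth_idmap.
Qed.

Lemma transition_id c q u : chart_dom c q -> 'd (c \o chart_inv c) (c q) u = u.
Proof.
move=> cq.
have E : \forall y \near c q, id y = (c \o chart_inv c) y.
  by apply: filterS (near_chart_img cq) => y cy; rewrite /= chart_invK.
have di : is_diff (c q) (@id 'rV[R]_n) id by exact: is_diff_id.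
have [_ ->] := diff_near_eq E (ex_diff (is_diff_def:=di)).
by rewrite diff_val.
Qed.

(** Both coordinate changes pass through the chart that represents the tangent
    space at [q], and that chart cancels. *)
Lemma to_chart_coord_field c d q v : atlas c -> atlas d ->
  chart_dom c q -> chart_dom d q ->
  to_chart d q (coord_field c v q) = 'd (d \o chart_inv c) (c q) v.
Proof.
move=> ac ad cq dq; apply: esym.
exact: (transition_chain v ac (chart_at_atlas q) ad cq (chart_at_dom q) dq).
Qed.

Lemma coord_field_chart_at p v : coord_field (chart_at p) v p = v.
Proof. by rewrite /coord_field transition_id //; exact: chart_at_dom. Qed.

Lemma to_chart_chart_at p u : to_chart (chart_at p) p u = u.
Proof. by rewrite /to_chart transition_id //; exact: chart_at_dom. Qed.

Lemma coord_field_to_chart c q u : atlas c -> chart_dom c q ->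
  coord_field c (to_chart c q u) q = u.
Proof.
move=> ac cq; have aq := chart_at_atlas q; have dq := chart_at_dom q.
by rewrite -[RHS](transition_id u dq); exact/esym/transition_chain.
Qed.

Lemma to_chartZ c a v q : to_chart c q (a *: v) = a *: to_chart c q v.
Proof. by rewrite /to_chart linearZ. Qed.

Lemma zero_field_smooth : smooth_vf (fun _ : M => 0).
Proof.
move=> c ac k; have -> : vf_repr c (fun _ : M => 0) = cst 0; last exact: Ck_cst.
by apply/funext => y; rewrite /vf_repr /to_chart linear0.
Qed.

(** A constant coordinate field is cut off by a bump function that is supported
    in the chart, and extended by zero.  The support is the image of a compact
    set; Hausdorffness makes it closed in the manifold, so that the extension is
    smooth everywhere. *)
Lemma extend_coord_field c p v : atlas c -> chart_dom c p ->
  exists X : M -> 'rV[R]_n, exists beta : 'rV[R]_n -> R,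
    [/\ smooth_vf X,
        (forall q, chart_dom c q -> X q = beta (c q) *: coord_field c v q),
        differentiable beta (c p), beta (c p) = 1 &
        forall w, 'd beta (c p) w = 0].
Proof.
move=> ac cp.
have [r r0 rI] : exists2 r : R, 0 < r &
    forall y, `|y - c p| <= r -> chart_img c y.
  have /nbhs_ballP[r /= r0 rI] := near_chart_img cp.
  exists (r / 2); first by rewrite divr_gt0.
  move=> y yr; apply: rI; rewrite -ball_normE /= distrC.
  by apply: le_lt_trans yr _; rewrite ltr_pdivrMr // ltr_pMr // ltr1n.
have [beta [sb b1 db b0]] := bump_function (c p) r0.
pose X q := if `[< chart_dom c q >] then beta (c q) *: coord_field c v q else 0.
have XE q : chart_dom c q -> X q = beta (c q) *: coord_field c v q.
  by move=> cq; rewrite /X asboolT.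
pose K := chart_inv c @` [set y | `|y - c p| <= r].
have cK : closed K.
  apply: compact_closed; first exact: manifold_hausdorff.
  apply: continuous_compact.
    apply: continuous_in_subspaceT => y /set_mem /rI cy.
    exact: chart_inv_continuous.
  apply: bounded_closed_compact.
    exists (r + `|c p|); split; first exact: num_real.
    move=> b /ltW rb y yr; apply: le_trans rb.
    by rewrite -[y](subrK (c p)); apply: le_trans (ler_normD _ _) _; rewrite lerD2r.
  have -> : [set y | `|y - c p| <= r] = closed_ball_ Num.norm (c p) r.
    by apply/seteqP; split => y /=; rewrite /closed_ball_ /= distrC.
  by rewrite -closed_ballE //; exact: closed_ball_closed.
have Kc : K `<=` chart_dom c by move=> _ [y /rI /chart_inv_dom cy <-].
have X0 q : ~ K q -> X q = 0.
  move=> Kq; rewrite /X; case: asboolP => // cq.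
  rewrite b0 ?scale0r // leNgt; apply/negP => /ltW qr.
  by apply: Kq; exists (c q) => //; rewrite chart_mapK.
exists X, beta; split => //; last by have [+ _] := sb 1%N; apply.
move=> d ad k; apply: Ck_local => y dy.
(* Over the chart domain the field, read in [d], is [beta] composed with the
   transition map [T], times the image of [v] under the differential of the
   inverse transition; off the support of [beta] it vanishes. *)
have [cy|ncy] := pselect (chart_dom c (chart_inv d y)).
  exists (d @` (chart_dom d `&` chart_dom c)).
    exists (chart_inv d y); last exact: chart_invK.
    by split => //; exact: chart_inv_dom.
  pose T := c \o chart_inv d.
  have oB : open (d @` (chart_dom d `&` chart_dom c)).
    by apply: chart_overlap_open; exact: chart_dom_open.
  have oB' : open (c @` (chart_dom c `&` chart_dom d)).
    by apply: chart_overlap_open; exact: chart_dom_open.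
  have CT : Ck k (d @` (chart_dom d `&` chart_dom c)) T.
    exact: atlas_compatible.
  have [_ CS] := atlas_compatible ac ad k.+1.
  have : Ck k (d @` (chart_dom d `&` chart_dom c)) (fun z => (beta \o T) z *:
     ((fun w => 'd (d \o chart_inv c) w v) \o T) z).
    apply: CkZ => //; first by apply: Ck_comp CT (sb k).
    apply: Ck_comp CT (CS v) => // _ [q [dq cq] <-].
    by exists q => //; rewrite /T /= chart_mapK.
  apply: Ck_eq => // _ /set_mem[q [dq cq] <-].
  rewrite /vf_repr /T /= chart_mapK // XE //.
  by rewrite to_chartZ (to_chart_coord_field v ac ad cq dq).
exists (d @` (chart_dom d `&` ~` K)).
  exists (chart_inv d y); last exact: chart_invK.
  by split; [exact: chart_inv_dom|move=> /Kc].
apply: (@Ck_eq _ _ _ _ _ (cst 0)); [|move=> _ /set_mem[q [dq Kq] <-]|exact: Ck_cst].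
  by apply: chart_overlap_open; exact: closed_openC.
by rewrite /vf_repr /= chart_mapK // X0 // /to_chart linear0.
Qed.

End Fields.

(** * Riemannian submersions *)

Section SubmersionAlgebra.
Context {R : realType} (m n : nat).
Variables (g : 'rV[R]_m -> 'rV[R]_m -> R) (h : 'rV[R]_n -> 'rV[R]_n -> R).
Hypothesis g_lin : forall u, scalar (g u).
Hypothesis g_sym : forall u v, g u v = g v u.
Hypothesis g_pos : forall u, u != 0 -> 0 < g u u.
Hypothesis h_lin : forall u, scalar (h u).
Hypothesis h_sym : forall u v, h u v = h v u.
Variable T : {linear 'rV[R]_m -> 'rV[R]_n}.
Hypothesis T_isometry : forall u, (forall w, T w = 0 -> g u w = 0) ->
  h (T u) (T u) = g u u.

Lemma horizontal_vertical u : exists u' w,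
  [/\ u = u' + w, T w = 0, forall z, T z = 0 -> g u' z = 0 & T u = T u'].
Proof.
have [w Tw hor] := orthogonal_projection_ker g_lin g_sym g_pos T u.
by exists (u - w), w; split; rewrite ?subrK // linearB Tw subr0.
Qed.

Lemma submersion_le u : h (T u) (T u) <= g u u.
Proof.
have [u' [w [-> Tw hor TE]]] := horizontal_vertical u.
rewrite linearD Tw addr0 T_isometry //.
rewrite (innerDr g_lin) !(innerDl g_lin g_sym) (hor _ Tw) (g_sym w u') (hor _ Tw).
rewrite addr0 add0r lerDl; have [->|/g_pos/ltW//] := eqVneq w 0.
by rewrite (inner0r g_lin).
Qed.

(** Polarisation of the isometry condition, applied to the horizontal part of [u]
    and to [v]. *)
Lemma submersion_inner u v : (forall w, T w = 0 -> g v w = 0) ->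
  h (T u) (T v) = g u v.
Proof.
move=> vh; have [u' [w [-> Tw uh TE]]] := horizontal_vertical u.
rewrite linearD Tw addr0 (innerDl g_lin g_sym) (g_sym w) (vh _ Tw) addr0.
have := @T_isometry (u' + v).
rewrite linearD !(innerDr h_lin) !(innerDl h_lin h_sym).
rewrite !(innerDr g_lin) !(innerDl g_lin g_sym) !T_isometry //.
rewrite (h_sym (T v)) (g_sym v).
have H z : T z = 0 -> g (u' + v) z = 0.
  by move=> Tz; rewrite (innerDl g_lin g_sym) uh // vh // addr0.
move=> /(_ H); lra.
Qed.

End SubmersionAlgebra.

Section Submersion.
Context {R : realType} (m n : nat) (M : manifold R m) (N : manifold R n).
Variables (gM : M -> 'rV[R]_m -> 'rV[R]_m -> R)
          (gN : N -> 'rV[R]_n -> 'rV[R]_n -> R).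
Hypothesis gM_metric : riemannian_metric gM.
Hypothesis gN_metric : riemannian_metric gN.
Variable F : M -> N.
Hypothesis F_submersion : riemannian_submersion gM gN F.

(** A differential of positive rank does not kill some [u], hence does not kill
    the horizontal part of [u]. *)
Lemma horizontal_nonzero p : (0 < n)%N -> exists2 v, v != 0 & horizontal gM F p v.
Proof.
have [gl gs gp _] := gM_metric; have [_ _ rk _] := F_submersion.
move=> n0; pose T := 'd (map_repr F p) (chart_at p p).
have [u Tu] : exists u, T u != 0.
  apply/not_existsP => T0.
  have J0 : jacobian (map_repr F p) (chart_at p p) = 0.
    apply/row_matrixP => i; rewrite rowE mul_rV_lin1 row0.
    by apply/eqP/negPn/negP; exact: T0.
  by have := rk p; rewrite J0 mxrank0 => n0'; rewrite -n0' in n0.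
have [v [w [_ _ hv TE]]] := horizontal_vertical (gl p) (gs p) (gp p) T u.
exists v => //; apply: contraNneq Tu => v0.
by rewrite TE v0 linear0.
Qed.

(** Two uses of the chain rule, with [F] composed with the identity of the source
    and with the identity of the target. *)
Lemma tangent_map_coord_field c d q v : atlas c -> atlas d ->
  chart_dom c q -> chart_dom d (F q) ->
  tangent_map F q (coord_field c v q)
  = coord_field d ('d (d \o F \o chart_inv c) (c q) v) (F q).
Proof.
move=> ac ad cq dq; have [sF _ _ _] := F_submersion.
have aq := chart_at_atlas q; have dmq := chart_at_dom q.
have aFq := chart_at_atlas (F q); have dFq := chart_at_dom (F q).
rewrite /tangent_map /coord_field /map_repr.
apply: etrans (esym (@chain_rule R m m n M M N idfun F c (chart_at q)
  (chart_at (F q)) q v _ sF ac aq aFq cq dmq dFq)) _.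
  exact: smooth_idmap.
have E := @chain_rule R m n n M N N F idfun c d (chart_at (F q)) q v sF
  smooth_idmap ac ad aFq cq dq dFq.
exact E.
Qed.

Definition coord_length2 (c : chart R m M) (v y : 'rV[R]_m) : R :=
  gM (chart_inv c y) (coord_field c v (chart_inv c y))
     (coord_field c v (chart_inv c y)).

(** The form pulled back from the target is below [gM], with equality at [p] on
    the horizontal vector [v], so both have the same derivative there; and the
    pulled back form is invariant under vertical fields. *)
Lemma submersion_vertical_derivative xi p v : smooth_vf xi ->
  vertical_vf F xi -> horizontal gM F p v ->
  'd (coord_length2 (chart_at p) v) (chart_at p p) (xi p) =
  - 2 * gM p ('d (vf_repr (chart_at p) xi) (chart_at p p) v) v.
Proof.
move=> sxi vxi hv.
have [sF _ _ iso] := F_submersion; have [gl gs gp gsm] := gM_metric.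
have [hl hs hp hsm] := gN_metric.
set c := chart_at p; set x0 := c p; set d := chart_at (F p).
have ac : atlas c by exact: chart_at_atlas.
have ad : atlas d by exact: chart_at_atlas.
have cp : chart_dom c p by exact: chart_at_dom.
have dp : chart_dom d (F p) by exact: chart_at_dom.
pose f := d \o F \o chart_inv c.
pose S := c @` (chart_dom c `&` F @^-1` chart_dom d).
have oS : open S by exact: chart_preimage_open.
have Sx0 : S x0 by exists p.
have Cf k : Ck k S f by have [_] := sF; apply.
have iK : chart_inv c x0 = p by exact: chart_mapK.
have nS (P : 'rV[R]_m -> Prop) : (forall q, chart_dom c q -> chart_dom d (F q) ->
    P (c q)) -> \forall y \near x0, P y.
  move=> H; apply: filterS (open_nbhs_nbhs (conj oS Sx0)) => _ [q [cq dq] <-].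
  exact: H.
pose Xi := vf_repr c xi.
have Xix0 : Xi x0 = xi p by rewrite /Xi /vf_repr iK to_chart_chart_at.
have dXi : differentiable Xi x0 by have [+ _] := sxi c ac 1%N; apply; exists p.
have TE u : tangent_map F p u = 'd f x0 u by [].
have dfXi : \forall y \near x0, 'd f y (Xi y) = 0.
  apply: nS => q cq dq; rewrite /Xi /vf_repr chart_mapK //.
  set w := to_chart c q (xi q).
  have E := tangent_map_coord_field w ac ad cq dq.
  have T0 : tangent_map F q (xi q) = 0 by exact: vxi.
  rewrite /w coord_field_to_chart // T0 -/w -/f in E.
  have := to_chart_coord_field ('d f (c q) w) ad ad dq dq.
  rewrite -E transition_id // => <-.
  by rewrite /to_chart linear0.
(* [a] is the push-forward of the constant field [v]; verticality of [xi] and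
   symmetry of second derivatives give its derivative along [xi p]. *)
pose a y := 'd f y v.
have da : differentiable a x0 by have [_ /(_ v)[+ _]] := Cf 2%N; exact.
have daxi : 'd a x0 (xi p) = - 'd f x0 ('d Xi x0 v).
  by rewrite -Xix0; exact: diff_annihilated_field oS Sx0 (Cf 2%N) dXi dfXi.
(* The metric of the target in the chart [d], along [f]: stationary in the
   direction [xi p], since [f] is. *)
pose G y u w := gN (chart_inv d (f y)) (coord_field d u (chart_inv d (f y)))
                   (coord_field d w (chart_inv d (f y))).
have Glin y u : scalar (G y u).
  by move=> b w z; rewrite /G /coord_field linearP hl.
have Gsym y u w : G y u w = G y w u by exact: hs.
have dG i j : differentiable (fun y => G y 'e_i 'e_j) x0 /\
    'd (fun y => G y 'e_i 'e_j) x0 (xi p) = 0.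
  pose Gij := (fun q => gN q (coord_field d 'e_i q) (coord_field d 'e_j q))
           \o chart_inv d.
  have df : differentiable f x0 by have [+ _] := Cf 1%N; exact.
  have dGij : differentiable Gij (f x0).
    have [+ _] := hsm d 'e_i 'e_j ad 1%N; apply.
    by exists (F p) => //; rewrite /f /= iK.
  split; first exact: (differentiable_comp df dGij).
  have := congr1 (fun h : 'rV[R]_m -> R => h (xi p)) (diff_comp df dGij).
  move=> E; apply: etrans E _; rewrite /= -TE.
  by rewrite (vxi p : tangent_map F p (xi p) = 0) linear0.
have [dQ QE] := diff_quadratic Glin Gsym (fun i j => (dG i j).1)
  (fun i j => (dG i j).2) da.
have G0 u w : G x0 u w = gN (F p) u w.
  have fx : chart_inv d (f x0) = F p by rewrite /f /= iK chart_mapK.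
  by rewrite /G fx !coord_field_chart_at.
have sub_inner u : gN (F p) (tangent_map F p u) (tangent_map F p v) = gM p u v.
  apply: (submersion_inner (gl p) (gs p) (gp p) (hl (F p)) (hs (F p))) => //.
  exact: iso.
have dL : differentiable (coord_length2 c v) x0.
  by have [+ _] := gsm c v v ac 1%N; apply; exists p.
pose Q y := G y (a y) (a y).
have QL q : chart_dom c q -> chart_dom d (F q) ->
    Q (c q) = gN (F q) (tangent_map F q (coord_field c v q))
                       (tangent_map F q (coord_field c v q)).
  move=> cq dq; rewrite (tangent_map_coord_field v ac ad cq dq) /Q /G.
  have fq : chart_inv d (f (c q)) = F q by rewrite /f /= !chart_mapK.
  by rewrite fq.
(* The submersion shortens vectors, and preserves the length of [v] at [p]. *)
have Lmin : \forall y \near x0, coord_length2 c v x0 - Q x0 <= coord_length2 c v y - Q y.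
  have Lx0 : coord_length2 c v x0 = gM p v v.
    by rewrite /coord_length2 iK coord_field_chart_at.
  have Qx0 : Q x0 = gM p v v.
    by apply: etrans (QL p cp dp) _; rewrite coord_field_chart_at sub_inner.
  rewrite Lx0 Qx0 subrr.
  apply: nS => q cq dq; rewrite subr_ge0 (QL q cq dq).
  rewrite /coord_length2 chart_mapK //.
  apply: (submersion_le (gl q) (gs q) (gp q) (T:='d (map_repr F q) (chart_at q q))).
  exact: iso.
have L0 : 'd (coord_length2 c v - Q) x0 (xi p) = 0.
  by apply: diff_at_min Lmin; exact: differentiableB.
have := congr1 (fun h : 'rV[R]_m -> R => h (xi p)) (diffB dL dQ).
move=> E; have : 0 = 'd (coord_length2 c v) x0 (xi p) - 'd Q x0 (xi p).
  exact: etrans (esym L0) E.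
move=> /esym/subr0_eq ->; apply: etrans QE _.
rewrite G0 daxi -!TE (innerNl (hl (F p)) (hs (F p))) sub_inner.
by rewrite mulrN mulNr.
Qed.

End Submersion.

(** * Kenmotsu manifolds *)

Section Kenmotsu.
Context {R : realType} (n : nat) (M : manifold R n).
Variables (phi : M -> {linear 'rV[R]_n -> 'rV[R]_n})
  (xi : M -> 'rV[R]_n) (eta : M -> {scalar 'rV[R]_n})
  (g : M -> 'rV[R]_n -> 'rV[R]_n -> R)
  (nabla : (M -> 'rV[R]_n) -> (M -> 'rV[R]_n) -> M -> 'rV[R]_n).
Hypothesis acm : almost_contact_metric phi xi eta g.
Hypothesis lc : levi_civita g nabla.
Hypothesis nabla_phi : forall X Y, smooth_vf X -> smooth_vf Y ->
  forall p, nabla X (fun q => phi q (Y q)) p - phi p (nabla X Y p)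
            = g p (phi p (X p)) (Y p) *: xi p - eta p (Y p) *: phi p (X p).

Lemma nabla_zero X p : smooth_vf X -> nabla X (fun _ => 0) p = 0.
Proof.
move=> sX; have [[_ _ _ nD _] _ _] := lc.
have s0 := @zero_field_smooth R n M.
have := nD X _ _ sX s0 s0 p.
have -> : (fun _ : M => 0 + 0 : 'rV[R]_n) = (fun _ => 0).
  by apply/funext => q; rewrite addr0.
by move/esym/eqP; rewrite -subr_eq0 addrK => /eqP.
Qed.

(** At [Y = xi] the defining identity becomes [phi (nabla_X xi) = phi X].  Applying
    [phi] once more determines [nabla_X xi] up to a multiple of [xi], and that
    multiple is fixed by the constant length of [xi]. *)
Lemma nabla_xi X p : smooth_vf X -> nabla X xi p = X p - eta p (X p) *: xi p.
Proof.
move=> sX; have sxi := acm_xi_smooth acm.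
have [gl gs _ _] := acm_metric acm.
have [_ _ metric] := lc.
have eta0 : eta p (nabla X xi p) = 0.
  have := metric X xi xi sX sxi sxi p.
  have -> : (fun q => g q (xi q) (xi q)) = cst 1.
    by apply/funext => q; rewrite -(acm_eta_dual acm) (acm_eta_xi acm).
  have -> : vf_deriv X (cst 1) p = 0.
    exact: (congr1 (fun h : 'rV[R]_n -> R => h (X p)) (diff_cst (1 : R) (chart_at p p))).
  rewrite (gs p (xi p)) -(acm_eta_dual acm); lra.
have := nabla_phi sX sxi p.
have -> : (fun q => phi q (xi q)) = (fun _ => 0).
  by apply/funext => q; exact: (acm_phi_xi acm).
rewrite nabla_zero // (acm_eta_xi acm) -(acm_eta_dual acm) (acm_eta_phi acm).
rewrite scale0r scale1r !sub0r => /oppr_inj /(congr1 (phi p)).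
rewrite !(acm_phi2 acm) eta0 scale0r addr0 => /(congr1 -%R).
by rewrite opprK opprD opprK.
Qed.

(** Metric compatibility, with [nabla_xi X] replaced by [[xi,X] + nabla_X xi]. *)
Lemma kenmotsu_derivative X p : smooth_vf X ->
  vf_deriv xi (fun q => g q (X q) (X q)) p
  = 2 * g p (lie_bracket xi X p) (X p)
    + 2 * (g p (X p) (X p) - eta p (X p) ^+ 2).
Proof.
move=> sX; have sxi := acm_xi_smooth acm.
have [gl gs _ _] := acm_metric acm.
have [_ torsion metric] := lc.
rewrite (metric xi X X) // (gs p (X p)) -(torsion xi X) // nabla_xi //.
rewrite !(innerDl (gl p) (gs p)) !(innerNl (gl p) (gs p)).
rewrite (innerDl (gl p) (gs p)) (innerNl (gl p) (gs p)) (innerZl (gl p) (gs p)).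
rewrite (gs p (xi p)) -(acm_eta_dual acm); ring.
Qed.

(** The same identity for the constant field [v] in a chart around [p].  The
    connection only accepts global fields, so the field is first cut off by a
    bump function [beta]; since [beta] is stationary at [p], it leaves no trace
    in the first derivatives there. *)
Lemma kenmotsu_vertical_derivative p v :
  'd (coord_length2 g (chart_at p) v) (chart_at p p) (xi p) =
  - 2 * g p ('d (vf_repr (chart_at p) xi) (chart_at p p) v) v
  + 2 * (g p v v - eta p v ^+ 2).
Proof.
have [gl gs _ gsm] := acm_metric acm.
set c := chart_at p; set x0 := c p.
have ac : atlas c by exact: chart_at_atlas.
have cp : chart_dom c p by exact: chart_at_dom.
have [X [beta [sX XE db b1 b0]]] := extend_coord_field v ac cp.
have Xp : X p = v by rewrite XE // b1 scale1r coord_field_chart_at.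
have near_c (P : 'rV[R]_n -> Prop) :
    (forall q, chart_dom c q -> P (c q)) -> \forall y \near x0, P y.
  by move=> H; apply: filterS (near_chart_img cp) => _ [q cq <-]; exact: H.
(* Near [p] the field [X], read in [c], is [beta] times the constant [v]; hence
   only the derivative of [xi] survives in the bracket at [p]. *)
have bracketE : lie_bracket xi X p = - 'd (vf_repr c xi) x0 v.
  have E : \forall y \near x0, beta y *: cst v y = vf_repr c X y.
    apply: near_c => q cq; rewrite /vf_repr chart_mapK // XE // to_chartZ.
    by rewrite (to_chart_coord_field v ac ac cq cq) transition_id.
  have dv := differentiable_cst v x0.
  have [_ E2] := diff_near_eq E (diff_scale db dv).1.
  have dX0 : 'd (vf_repr c X) x0 (xi p) = 0.
    apply: etrans (congr1 (fun h : 'rV[R]_n -> 'rV[R]_n => h (xi p)) E2) _.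
    apply: etrans (diff_scale_stationary db dv b1 (b0 (xi p))) _.
    exact: (congr1 (fun h : 'rV[R]_n -> 'rV[R]_n => h (xi p)) (diff_cst v x0)).
  rewrite /lie_bracket Xp.
  exact: etrans (congr1 (fun u => u - 'd (vf_repr c xi) x0 v) dX0) (sub0r _).
have lengthE : vf_deriv xi (fun q => g q (X q) (X q)) p
             = 'd (coord_length2 g c v) x0 (xi p).
  have dL : differentiable (coord_length2 g c v) x0.
    by have [+ _] := gsm c v v ac 1%N; apply; exists p.
  have d1 := (diff_scale db dL).1.
  have E : \forall y \near x0, beta y *: (beta y *: coord_length2 g c v y)
      = ((fun q => g q (X q) (X q)) \o chart_inv c) y.
    apply: near_c => q cq; rewrite /coord_length2 /= chart_mapK // XE //.
    by rewrite (innerZl (gl q) (gs q)) (innerZr (gl q)).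
  have [_ E3] := diff_near_eq E (diff_scale db d1).1.
  apply: etrans (congr1 (fun h : 'rV[R]_n -> R => h (xi p)) E3) _.
  apply: etrans (diff_scale_stationary db d1 b1 (b0 (xi p))) _.
  exact: (diff_scale_stationary db dL b1 (b0 (xi p))).
rewrite -lengthE kenmotsu_derivative // bracketE Xp (innerNl (gl p) (gs p)).
by rewrite mulrN mulNr.
Qed.

End Kenmotsu.

Theorem theorem8 (R : realType) (m n : nat) (n_gt0 : (0 < n)%N)
  (M : manifold R (2 * m + 1))
  (M_connected : connected [set: M])
  (phi : M -> {linear 'rV[R]_(2 * m + 1) -> 'rV[R]_(2 * m + 1)})
  (xi : M -> 'rV[R]_(2 * m + 1))
  (eta : M -> {scalar 'rV[R]_(2 * m + 1)})
  (gM : M -> 'rV[R]_(2 * m + 1) -> 'rV[R]_(2 * m + 1) -> R)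
  (M_kenmotsu : kenmotsu phi xi eta gM)
  (N : manifold R n)
  (gN : N -> 'rV[R]_n -> 'rV[R]_n -> R)
  (gN_metric : riemannian_metric gN) :
  ~ exists F : M -> N, riemannian_submersion gM gN F /\ vertical_vf F xi.
Proof.
have [acm [nabla [lc nabla_phi]]] := M_kenmotsu.
have gM_metric := acm_metric acm.
case=> F [F_sub vxi].
have [c _] := manifold_nonempty M.
have [v v0 hv] := horizontal_nonzero gM_metric F_sub c n_gt0.
have sxi := acm_xi_smooth acm.
have := kenmotsu_vertical_derivative acm lc nabla_phi c v.
rewrite (submersion_vertical_derivative gM_metric gN_metric F_sub sxi vxi hv).
have -> : eta c v = 0 by rewrite (acm_eta_dual acm); exact: hv (vxi c).
have [_ _ gp _] := gM_metric.
have := gp c v v0; rewrite expr0n /=; lra.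
Qed.
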